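(* Let $\alpha\in[0,1]$. (a) Let $G_1$ and $G_2$ be regular graphs and let $H$ be an arbitrary graph. If $G_1$ and $G_2$ are $A_\alpha$-cospectral, then $G_1\dot\vee_Q H$ and $G_2\dot\vee_Q H$ are $A_\alpha$-cospectral. (b) Let $G$ be a regular graph and let $H_1$ and $H_2$ be graphs with $\Upsilon_{A_\alpha(H_1)}(\nu)=\Upsilon_{A_\alpha(H_2)}(\nu)$. If $H_1$ and $H_2$ are $A_\alpha$-cospectral, then $G\dot\vee_Q H_1$ and $G\dot\vee_Q H_2$ are $A_\alpha$-cospectral.
   Context: All graphs are finite, undirected and simple. For a graph $G$ with adjacency matrix $A(G)$ and diagonal degree matrix $D(G)$, put $A_\alpha(G)=\alpha D(G)+(1-\alpha)A(G)$. The $A_\alpha$-spectrum of $G$ is the multiset of eigenvalues of $A_\alpha(G)$. Two non-isomorphic graphs possessing the same $A_\alpha$-spectrum are called $A_\alpha$-cospectral. For an $n\times n$ matrix $M$, the $M$-coronal is the rational function $\Upsilon_M(\nu)=\mathbf 1_n^T(\nu I_n-M)^{-1}\mathbf 1_n$, where $\mathbf 1_n$ is the all-ones column vector. The $Q$-graph $\mathcal Q(G)$ is obtained from $G$ by inserting a new vertex into each edge of $G$ (so each edge is subdivided: the new vertex is adjacent to the two ends of the edge, and the original edge is no longer present), and then making two new vertices adjacent whenever they lie on adjacent edges of $G$ (distinct edges sharing an endpoint). The $Q$-vertex join $G_1\dot\vee_Q G_2$ is obtained from the disjoint union of $\mathcal Q(G_1)$ and $G_2$ by joining each original vertex of $G_1$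 in $\mathcal Q(G_1)$ to every vertex of $G_2$. *)

(* Defs.v *)
From HB Require Import structures.
From mathcomp Require Import all_boot all_order all_algebra.
From mathcomp Require Import reals.
From mathcomp Require Import complex.

Set Implicit Arguments.
Unset Strict Implicit.
Unset Printing Implicit Defensive.

Import Order.TTheory GRing.Theory Num.Theory.

Local Open Scope ring_scope.

Record sgraph := SGraph {
  vertex :> finType;
  adj : rel vertex;
  adj_sym : symmetric adj;
  adj_irr : irreflexive adj }.

Definition isomorphic (G H : sgraph) : Prop :=
  exists f : G -> H, bijective f /\ forall x y, adj (f x) (f y) = adj x y.

Definition degree (G : sgraph) (x : G) : nat := #|[set y | adj x y]|.

Definition regular (G : sgraph) : Prop :=
  exists r : nat, forall x : G, degree x = r.

Definition edges (G : sgraph) : {set {set G}} :=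
  [set [set p.1; p.2] | p : G * G in [set q : G * G | adj q.1 q.2]].

Definition edge (G : sgraph) : finType := {e : {set G} | e \in edges G}.

(* inl x is the original vertex x, inr e the vertex inserted into the edge e. *)
Definition Qadj (G : sgraph) (u v : G + edge G) : bool :=
  match u, v with
  | inl _, inl _ => false
  | inl x, inr e | inr e, inl x => x \in val e
  | inr e, inr f => (e != f) && (val e :&: val f != set0)
  end.

Lemma Qadj_sym (G : sgraph) : symmetric (@Qadj G).
Proof. by move=> [x|e] [y|f] //=; rewrite eq_sym setIC. Qed.

Lemma Qadj_irr (G : sgraph) : irreflexive (@Qadj G).
Proof. by move=> [x|e] //=; rewrite eqxx. Qed.

Definition Qgraph (G : sgraph) : sgraph := SGraph (@Qadj_sym G) (@Qadj_irr G).

Definition original (G : sgraph) (a : Qgraph G) : bool :=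
  if a is inl _ then true else false.

Definition Qjoin_adj (G H : sgraph) (u v : Qgraph G + H) : bool :=
  match u, v with
  | inl a, inl b => adj a b
  | inr x, inr y => adj x y
  | inl a, inr _ | inr _, inl a => original a
  end.

Lemma Qjoin_adj_sym (G H : sgraph) : symmetric (@Qjoin_adj G H).
Proof.
by move=> [a|x] [b|y] //=; [exact: Qadj_sym | exact: adj_sym]. Qed.

Lemma Qjoin_adj_irr (G H : sgraph) : irreflexive (@Qjoin_adj G H).
Proof. by move=> [a|x] /=; [exact: Qadj_irr | exact: adj_irr]. Qed.

Definition Qvertex_join (G H : sgraph) : sgraph :=
  SGraph (@Qjoin_adj_sym G H) (@Qjoin_adj_irr G H).

Section Matrices.
Variable R : realType.

Definition adj_mx (G : sgraph) : 'M[R]_#|G| :=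
  \matrix_(i, j) (adj (enum_val i) (enum_val j))%:R.

Definition degree_mx (G : sgraph) : 'M[R]_#|G| :=
  diag_mx (\row_i (degree (enum_val i))%:R).

Definition Aalpha (alpha : R) (G : sgraph) : 'M[R]_#|G| :=
  alpha *: degree_mx G + (1 - alpha) *: adj_mx G.

(* The multiset of complex eigenvalues, given by its multiplicity function:
   the multiplicity of z as a root of the characteristic polynomial.  All
   eigenvalues are counted, so equal spectra force equal orders. *)
Definition spectrum (n : nat) (M : 'M[R]_n) : R[i] -> nat :=
  fun z => mup z (char_poly (map_mx (real_complex R) M)).

Definition Acospectral (alpha : R) (G H : sgraph) : Prop :=
  ~ isomorphic G H /\ spectrum (Aalpha alpha G) =1 spectrum (Aalpha alpha H).

(* The indeterminate nu is 'X, and the inverse is taken over the field R(X) of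
   rational functions, where nu I - M is always invertible. *)
Definition coronal (n : nat) (M : 'M[R]_n) : {fraction {poly R}} :=
  let nu : {fraction {poly R}} := tofrac 'X in
  let M' : 'M[{fraction {poly R}}]_n := map_mx (fun a => tofrac a%:P) M in
  let one : 'cV[{fraction {poly R}}]_n := const_mx 1 in
  (one^T *m invmx (nu%:M - M') *m one) 0 0.

End Matrices.

(* Main.v *)
(* Cospectrality.  Write l - A_alpha(X), X the join, in blocks indexed by the
   original vertices V, the inserted vertices E and H, and let B be the V x E
   incidence matrix; then B B^T = A(G) + r I and the line graph of G has
   adjacency matrix B^T B - 2 I.  A Schur complement eliminates H, whose only
   trace is its coronal at l - alpha |V|; a row operation turns the E-block
   into a scalar matrix, and a second Schur complement eliminates E.  What is
   left is x I + y A_alpha(G) + z J with x, y, z depending on G only through r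
   and |V|, and J (all ones) is treated as a rank-one perturbation along an
   eigenvector.

   Non-isomorphism in H.  An isomorphism between the joins of G with H1 and H2
   is a bijection W + H1 -> W + H2 with W the vertices of Q(G); its
   first-return map H1 -> H2 is an isomorphism, because adjacency between W and
   H_i depends only on the vertex in W.

   Non-isomorphism in G.  If r = 0 or G is complete, r and |V| determine G.
   Otherwise an isomorphism between the joins must send original vertices to
   original vertices, and two of these are adjacent in G exactly when they have
   a common neighbour among the inserted vertices. *)

Require Import Defs.
From mathcomp Require Import all_boot all_order all_fingroup all_algebra.
From mathcomp Require Import reals complex.
From mathcomp Require Import ring zify.

Set Implicit Arguments.
Unset Strict Implicit.
Unset Printing Implicit Defensive.

Import Order.TTheory GRing.Theory Num.Theory.

Local Open Scope ring_scope.

(** * Characteristic polynomials and matrices indexed by finite types *)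

(** Monic polynomials split over the closed field [R[i]], so root multiplicities determine them; the
    embedding of [R] is injective on polynomials. *)
Lemma char_poly_eq_spectrum (R : realType) m n (A : 'M[R]_m) (B : 'M[R]_n) :
  spectrum A =1 spectrum B -> char_poly A = char_poly B.
Proof.
move=> eqAB; apply: (map_poly_inj (real_complex R)); rewrite !map_char_poly.
have split_monic (p : {poly R[i]}) : p \is monic ->
    {r : seq R[i] | p = \prod_(z <- r) ('X - z%:P)}.
  move=> /monicP lp; have [r pr] := closed_field_poly_normal p.
  by exists r; rewrite pr lp scale1r.
have [r Ar] := split_monic _ (char_poly_monic (map_mx (real_complex R) A)).
have [s Bs] := split_monic _ (char_poly_monic (map_mx (real_complex R) B)).
rewrite Ar Bs; apply: perm_big; apply/allP => z _ /=; apply/eqP.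
by rewrite -!mu_prod_XsubC -Ar -Bs; apply: eqAB.
Qed.

Lemma spectrum_eq_char_poly (R : realType) m n (A : 'M[R]_m) (B : 'M[R]_n) :
  char_poly A = char_poly B -> spectrum A =1 spectrum B.
Proof. by move=> eqAB z; rewrite /spectrum -!map_char_poly eqAB. Qed.

Lemma eq_char_poly_size (R : nzRingType) m n (A : 'M[R]_m) (B : 'M[R]_n) :
  char_poly A = char_poly B -> m = n.
Proof. by move=> /(congr1 (size \o val)) /=; rewrite !size_char_poly => -[]. Qed.

(** This lets characteristic polynomials be compared only where the eliminated blocks are
    invertible. The product [w * (p - q)] vanishes everywhere, in particular at more naturals than
    its degree. *)
Lemma poly_eq_off_roots (R : numDomainType) (w p q : {poly R}) :
  w != 0 -> (forall x, w.[x] != 0 -> p.[x] = q.[x]) -> p = q.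
Proof.
move=> w0 eqpq; apply/eqP; rewrite -subr_eq0.
have : w * (p - q) = 0.
  set d := w * _.
  apply: (@roots_geq_poly_eq0 _ _ [seq i%:R | i <- iota 0 (size d)]).
  - apply/allP => x _; rewrite rootE !hornerE.
    by have [->|/eqpq->] := eqVneq w.[x] 0; rewrite ?mul0r ?subrr ?mulr0.
  - by rewrite map_inj_uniq ?iota_uniq //; apply: mulrIn; rewrite oner_eq0.
  - by rewrite size_map size_iota.
by move/eqP; rewrite mulf_eq0 (negPf w0).
Qed.

Lemma horner_char_poly (R : comNzRingType) n (A : 'M[R]_n) x :
  (char_poly A).[x] = \det (x%:M - A).
Proof.
rewrite -[_.[x]]/(horner_eval x _) -det_map_mx; congr (\det _).
apply/matrixP => i j; rewrite !mxE /= /horner_eval !hornerE.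
by rewrite hornerMn hornerX.
Qed.

(** For nonzero [y] each side is the value of the characteristic polynomial at [- x / y], rescaled
    by a power of [- y]. *)
Lemma det_scalar_add_eq (F : fieldType) m n (A : 'M[F]_m) (B : 'M[F]_n) x y :
  char_poly A = char_poly B -> \det (x%:M + y *: A) = \det (x%:M + y *: B).
Proof.
move=> eqAB; have mn := eq_char_poly_size eqAB; subst n.
have [->|y0] := eqVneq y 0; first by rewrite !scale0r.
have rescale (C : 'M[F]_m) :
    \det (x%:M + y *: C) = (- y) ^+ m * (char_poly C).[- x / y].
  rewrite horner_char_poly -detZ scalerBr scale_scalar_mx scaleNr opprK.
  by congr (\det (_%:M + _)); field.
by rewrite !rescale eqAB.
Qed.

Lemma det_block_schur (F : fieldType) m n (A : 'M[F]_m) B C (D : 'M[F]_n) :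
  D \in unitmx ->
  \det (block_mx A B C D) = \det D * \det (A - B *m invmx D *m C).
Proof.
move=> uD.
have -> : block_mx A B C D =
    block_mx (A - B *m invmx D *m C) B 0 D *m block_mx 1%:M 0 (invmx D *m C) 1%:M.
  rewrite mulmx_block !mulmx1 !mulmx0 !add0r !mulmxA subrK.
  by rewrite mulmxV // mul1mx.
by rewrite det_mulmx det_ublock det_lblock !det1 !mulr1 mulrC.
Qed.

Lemma mulmx_const_square (R : comNzRingType) n (M : 'M[R]_n) s :
  M *m const_mx 1 = s *: const_mx 1 :> 'cV_n ->
  M *m const_mx 1 = s *: const_mx 1 :> 'M_n.
Proof.
have -> : const_mx 1 = (const_mx 1 : 'cV_n) *m const_mx 1 :> 'M[R]_n.
  by apply/matrixP => i j; rewrite !mxE big_ord1 !mxE mulr1.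
by rewrite mulmxA scalemxAl => ->.
Qed.

(** With [J] all ones, [M *m J = s *: J], so the sum factors as [M] times a matrix that depends only
    on [n], [z] and [s]. *)
Lemma det_add_const_mx (F : fieldType) n (M : 'M[F]_n) s z : s != 0 ->
  M *m const_mx 1 = s *: const_mx 1 :> 'cV_n ->
  \det (M + z *: const_mx 1) = \det M * \det (1%:M + (z / s) *: const_mx 1 : 'M_n).
Proof.
move=> s0 M1; rewrite -det_mulmx mulmxDr mulmx1 -scalemxAr.
rewrite (mulmx_const_square M1).
by rewrite scalerA divfK.
Qed.

Lemma det_reindex (R : comNzRingType) m n (A : 'M[R]_m) (B : 'M[R]_n)
    (h : 'I_m -> 'I_n) : bijective h ->
  (forall i j, A i j = B (h i) (h j)) -> \det A = \det B.
Proof.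
move=> bh AB; have mn := bij_eq_card bh; rewrite !card_ord in mn; subst n.
pose s := perm (bij_inj bh).
have -> : A = row_perm s (col_perm s B).
  by apply/matrixP => i j; rewrite AB !mxE !permE.
rewrite row_permE col_permE !det_mulmx !det_perm mulrCA mulrA.
by rewrite -mulrA odd_permV -signr_addb addbb mulr1.
Qed.

Section FinTypeIndexedMatrices.
Variable R : comNzRingType.
Implicit Types S T U : finType.

(** Indexing by elements instead of ordinals turns products into sums over vertices or edges, and
    sum types into block matrices. *)
Definition fmx S T (f : S -> T -> R) : 'M[R]_(#|S|, #|T|) :=
  \matrix_(i, j) f (enum_val i) (enum_val j).

Lemma eq_fmx S T (f g : S -> T -> R) : f =2 g -> fmx f = fmx g.
Proof. by move=> fg; apply/matrixP => i j; rewrite !mxE fg. Qed.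

Lemma tr_fmx S T (f : S -> T -> R) : (fmx f)^T = fmx (fun x y => f y x).
Proof. by apply/matrixP => i j; rewrite !mxE. Qed.

Lemma fmxD S T (f g : S -> T -> R) :
  fmx f + fmx g = fmx (fun x y => f x y + g x y).
Proof. by apply/matrixP => i j; rewrite !mxE. Qed.

Lemma fmxZ S T a (f : S -> T -> R) : a *: fmx f = fmx (fun x y => a * f x y).
Proof. by apply/matrixP => i j; rewrite !mxE. Qed.

Lemma fmxN S T (f : S -> T -> R) : - fmx f = fmx (fun x y => - f x y).
Proof. by apply/matrixP => i j; rewrite !mxE. Qed.

Lemma fmxM S T U (f : S -> T -> R) (g : T -> U -> R) :
  fmx f *m fmx g = fmx (fun x z => \sum_y f x y * g y z).
Proof.
apply/matrixP => i j; rewrite !mxE [RHS](reindex_onto enum_val enum_rank).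
  by apply: eq_big => k; rewrite ?enum_valK ?eqxx // !mxE.
by move=> y _; rewrite enum_rankK.
Qed.

Lemma fmx_scalar T a : fmx (fun x y : T => a * (x == y)%:R) = a%:M.
Proof.
by apply/matrixP => i j; rewrite !mxE (inj_eq enum_val_inj) mulr_natr.
Qed.

Lemma fmx_const S T a : fmx (fun (_ : S) (_ : T) => a) = const_mx a.
Proof. by apply/matrixP => i j; rewrite !mxE. Qed.

Lemma det_fmx_sum S T (f : S + T -> S + T -> R) :
  \det (fmx f) =
  \det (block_mx (fmx (fun x y => f (inl x) (inl y)))
                 (fmx (fun x y => f (inl x) (inr y)))
                 (fmx (fun x y => f (inr x) (inl y)))
                 (fmx (fun x y => f (inr x) (inr y)))).
Proof.
pose h (i : 'I_#|{: S + T}|) : 'I_(#|S| + #|T|) :=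
  match enum_val i with
  | inl x => lshift _ (enum_rank x) | inr y => rshift _ (enum_rank y) end.
pose h' (j : 'I_(#|S| + #|T|)) : 'I_#|{: S + T}| :=
  match split j with
  | inl i => enum_rank (inl (enum_val i))
  | inr i => enum_rank (inr (enum_val i)) end.
have hh' : cancel h h'.
  move=> i; rewrite /h /h'; case E: (enum_val i) => [x|y].
    by rewrite (unsplitK (inl _)) enum_rankK -E enum_valK.
  by rewrite (unsplitK (inr _)) enum_rankK -E enum_valK.
apply: (@det_reindex _ _ _ _ _ h).
  by apply: inj_card_bij (can_inj hh') _; rewrite !card_ord card_sum.
move=> i j; rewrite mxE /h; case: (enum_val i) => x; case: (enum_val j) => y;
  by rewrite ?(block_mxEul, block_mxEur, block_mxEdl, block_mxEdr) !mxE !enum_rankK.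
Qed.

End FinTypeIndexedMatrices.

(** * Edges and degrees *)

Lemma in_edges (G : sgraph) (e : {set G}) :
  reflect (exists x y, adj x y /\ e = [set x; y]) (e \in edges G).
Proof.
apply: (iffP imsetP) => [[[x y]]|[x [y [xy ->]]]].
  by rewrite inE => /= xy ->; exists x, y.
by exists (x, y); rewrite ?inE.
Qed.

Lemma edge_ends (G : sgraph) (e : edge G) :
  exists x y, [/\ adj x y, x != y & val e = [set x; y]].
Proof.
have /in_edges [x [y [xy eE]]] := valP e; exists x, y; split => //.
by apply: contraTneq xy => ->; rewrite adj_irr.
Qed.

Lemma card_edge (G : sgraph) (e : edge G) : #|val e| = 2%N.
Proof. by have [x [y [_ xy ->]]] := edge_ends e; rewrite cards2 xy. Qed.

Lemma in_edge2 (G : sgraph) (e : edge G) x y :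
  x != y -> x \in val e -> y \in val e -> val e = [set x; y].
Proof.
move=> xy xe ye; apply/esym/eqP; rewrite eqEcard card_edge cards2 xy leqnn andbT.
by apply/subsetP => z; rewrite !inE => /orP [] /eqP ->.
Qed.

Lemma edge_adj (G : sgraph) (e : edge G) x y :
  x != y -> x \in val e -> y \in val e -> adj x y.
Proof.
move=> xy xe ye; have eE := in_edge2 xy xe ye.
have [u [v [uv _ eE']]] := edge_ends e.
have : x \in [set u; v] by rewrite -eE'.
have : y \in [set u; v] by rewrite -eE'.
rewrite !inE => /orP [] /eqP yE /orP [] /eqP xE; move: xy; rewrite xE yE ?eqxx //.
by rewrite adj_sym.
Qed.

Lemma adj_edge (G : sgraph) (x y : G) :
  adj x y -> {e : edge G | val e = [set x; y]}.
Proof.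
move=> xy; have xyE : [set x; y] \in edges G by apply/in_edges; exists x, y.
by exists (Sub [set x; y] xyE); rewrite SubK.
Qed.

Lemma card_edge_at2 (G : sgraph) (x y : G) : x != y ->
  #|[set e : edge G | (x \in val e) && (y \in val e)]| = adj x y.
Proof.
move=> xy; case: (boolP (adj x y)) => [/adj_edge [e eE]|nxy].
  suff -> : [set e : edge G | (x \in val e) && (y \in val e)] = [set e].
    by rewrite cards1.
  apply/setP => f; rewrite !inE; apply/andP/eqP => [[xf yf]|->].
    by apply: val_inj; rewrite eE; apply: in_edge2.
  by rewrite eE !inE !eqxx orbT.
apply/eqP; rewrite cards_eq0; apply/eqP/setP => e; rewrite !inE.
by apply: contraNF nxy => /andP []; apply: edge_adj.
Qed.

(** Double counting of the pairs formed by an edge at [x] and its other end. *)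
Lemma card_edge_at (G : sgraph) (x : G) :
  #|[set e : edge G | x \in val e]| = degree x.
Proof.
have deg_other (e : edge G) : x \in val e ->
    #|[set y in val e | y != x]| = 1%N.
  move=> xe; have := card_edge e; rewrite (cardsD1 x) xe add1n => -[<-].
  by apply: eq_card => y; rewrite !inE andbC.
rewrite -sum1_card (eq_bigr (fun e : edge G => #|[set y in val e | y != x]|)); last first.
  by move=> e; rewrite inE => /deg_other.
under eq_bigr do rewrite -sum1_card big_mkcond /=.
rewrite exchange_big /= /degree -sum1_card [RHS]big_mkcond /=; apply: eq_bigr => y _.
rewrite inE -big_mkcondr /=; have [->|yx] := eqVneq y x.
  by rewrite adj_irr big_pred0 // => e; rewrite !inE eqxx !andbF.
rewrite -[RHS]/(nat_of_bool (adj x y)) -card_edge_at2 1?eq_sym // -sum1_card.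
by apply: eq_bigl => e; rewrite !inE yx andbT.
Qed.

Lemma edge_at (G : sgraph) (x : G) : (0 < degree x)%N -> exists e : edge G, x \in val e.
Proof. by rewrite -card_edge_at card_gt0 => /set0Pn [e]; rewrite inE; exists e. Qed.

(** Two common vertices would determine the edge. So off the diagonal, [B^T B] for the incidence
    matrix [B] is the adjacency of inserted vertices. *)
Lemma card_edgeI (G : sgraph) (e f : edge G) : e != f ->
  #|val e :&: val f| = (val e :&: val f != set0).
Proof.
move=> ef; rewrite -card_gt0; case: (posnP #|_ :&: _|) => [-> //|n0].
apply/eqP; rewrite eqn_leq n0 andbT; rewrite leqNgt; apply: contra ef => /card_gt1P.
case=> x [y [/setIP [xe xf] /setIP [ye yf] xy]].
by apply/eqP/val_inj; rewrite (in_edge2 xy xe ye) (in_edge2 xy xf yf).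
Qed.

Lemma sum_degree (G : sgraph) : (\sum_(x : G) degree x = 2 * #|edge G|)%N.
Proof.
under eq_bigr do rewrite -card_edge_at -sum1_card big_mkcond /=.
rewrite exchange_big /= mulnC -sum_nat_const; apply: eq_bigr => e _.
by rewrite -(card_edge e) -sum1_card [RHS]big_mkcond /=; apply: eq_bigr => x _; rewrite inE.
Qed.

Lemma regular_card_edge (G : sgraph) r : (forall x : G, degree x = r) ->
  (#|G| * r = 2 * #|edge G|)%N.
Proof. by move=> dr; rewrite -sum_degree (eq_bigr (fun=> r)) // sum_nat_const. Qed.

Lemma degreeE (G : sgraph) (x : G) : degree x = (\sum_y adj x y)%N.
Proof. by rewrite /degree -sum1dep_card big_mkcond /=; apply: eq_bigr => y _; case: adj. Qed.

Section JoinDegrees.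
Variables (G H : sgraph).
Local Notation X := (Qvertex_join G H).

Lemma degree_original (x : G) :
  @degree X (inl (inl x)) = (degree x + #|H|)%N.
Proof.
rewrite degreeE big_sumType /= big_sumType /= big1_eq add0n; congr (_ + _)%N.
  by rewrite -card_edge_at -sum1dep_card [RHS]big_mkcond /=; apply: eq_bigr => e _; case: (x \in _).
by rewrite sum1_card.
Qed.

(** The degree is the sum of the sizes of [val e :&: val f] over all [f]: the term [f = e] stands
    for the two ends of [e]. Exchanging sums gives [r] for each end. *)
Lemma degree_inserted r (e : edge G) : (forall x : G, degree x = r) ->
  @degree X (inl (inr e)) = (2 * r)%N.
Proof.
move=> dr; rewrite degreeE big_sumType /= big_sumType /= [X in (_ + X)%N]big1_eq addn0.
transitivity (\sum_(f : edge G) #|val e :&: val f|)%N.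
  rewrite [RHS](bigD1 e) //= setIid card_edge [X in (_ + X)%N](bigD1 e) //= eqxx add0n.
  congr (_ + _)%N.
    by rewrite -(card_edge e) -sum1_card [RHS]big_mkcond /=; apply: eq_bigr => x _; case: (x \in _).
  by apply: eq_bigr => f fe; rewrite eq_sym fe card_edgeI // eq_sym.
under eq_bigr do rewrite -sum1_card big_mkcond /=.
rewrite exchange_big /= -(card_edge e) -sum_nat_const [RHS]big_mkcond /=.
apply: eq_bigr => x _; rewrite -(dr x) -card_edge_at -sum1dep_card.
case: ifP => xe; last by rewrite big1 // => f _; rewrite inE xe.
by rewrite [RHS]big_mkcond; apply: eq_bigr => f _; rewrite inE xe.
Qed.

Lemma degree_second (h : H) : @degree X (inr h) = (#|G| + degree h)%N.
Proof.
rewrite [LHS]degreeE big_sumType /= big_sumType /= [X in (_ + X + _)%N]big1_eq addn0.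
by rewrite sum1_card -degreeE.
Qed.

End JoinDegrees.

(** * Regular graphs and coronals *)

Lemma AalphaE (R : realType) (alpha : R) (G : sgraph) :
  Aalpha alpha G = fmx (fun x y : G =>
    alpha * (degree x)%:R * (x == y)%:R + (1 - alpha) * (adj x y)%:R).
Proof.
apply/matrixP => i j; rewrite !mxE (inj_eq enum_val_inj).
by case: (i == j); rewrite ?mulr1n ?mulr0n ?mulr1 ?mulr0.
Qed.

Lemma tr_Aalpha (R : realType) (alpha : R) (G : sgraph) :
  (Aalpha alpha G)^T = Aalpha alpha G.
Proof.
rewrite AalphaE tr_fmx; apply: eq_fmx => x y; rewrite adj_sym eq_sym.
by case: eqVneq => [->|_]; rewrite ?mulr0.
Qed.

Lemma Aalpha_regular (R : realType) (alpha : R) (G : sgraph) r :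
  (forall x : G, degree x = r) ->
  Aalpha alpha G *m const_mx 1 = r%:R *: const_mx 1 :> 'cV_#|G|.
Proof.
move=> dr; apply/matrixP => i j; rewrite AalphaE !mxE mulr1.
under eq_bigr do rewrite !mxE mulr1.
rewrite (reindex_onto enum_rank enum_val) /=; last by move=> k _; rewrite enum_valK.
under eq_bigl do rewrite enum_rankK eqxx.
under eq_bigr do rewrite enum_rankK dr.
rewrite big_split /= -!mulr_sumr -!natr_sum -degreeE dr.
rewrite (bigD1 (enum_val i)) //= eqxx big1 ?addn0 => [|k /negPf]; last by rewrite eq_sym => ->.
by rewrite /=; ring.
Qed.

Lemma regular_eigenvalue (R : realType) (alpha : R) (G : sgraph) r :
  (0 < #|G|)%N -> (forall x : G, degree x = r) ->
  eigenvalue (Aalpha alpha G) r%:R.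
Proof.
move=> G0 dr; apply/eigenvalueP; exists (const_mx 1).
  rewrite -[LHS]trmxK trmx_mul tr_Aalpha trmx_const (Aalpha_regular _ dr).
  by apply/matrixP => i j; rewrite !mxE.
apply/eqP => /matrixP/(_ 0 (Ordinal G0)); rewrite !mxE => /eqP.
by rewrite oner_eq0.
Qed.

(** For [alpha] in the unit interval the entries are nonnegative with row sums [r]; the eigenvalue
    equation is read at a coordinate of largest absolute value. *)
Lemma regular_eigenvalue_le (R : realType) (alpha : R) (G : sgraph) r a :
  0 <= alpha <= 1 -> (forall x : G, degree x = r) ->
  eigenvalue (Aalpha alpha G) a -> a <= r%:R.
Proof.
move=> /andP [a0 a1] dr /eigenvalueP [v va v0].
have [i0 vi0] : exists i, v 0 i != 0.
  apply/existsP; apply: contraNT v0; rewrite negb_exists => /forallP v0.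
  by apply/eqP/rowP => i; rewrite mxE; apply/eqP; have := v0 i; rewrite negbK.
pose i := [arg max_(i > i0) `|v 0 i|]%O.
have vmax j : `|v 0 j| <= `|v 0 i|.
  by rewrite /i; case: Order.TotalTheory.arg_maxP => // k _; apply.
have vi : 0 < `|v 0 i| by apply: lt_le_trans (vmax i0); rewrite normr_gt0.
apply: le_trans (ler_norm a) _; rewrite -(ler_pM2r vi) -normrM.
have /matrixP/(_ 0 i) := va; rewrite !mxE => <-.
have Age0 k l : 0 <= Aalpha alpha G k l.
  by rewrite AalphaE !mxE; apply: addr_ge0; rewrite !mulr_ge0 ?ler0n // subr_ge0.
apply: le_trans (ler_norm_sum _ _ _) _.
have /matrixP/(_ i 0) := Aalpha_regular alpha dr; rewrite !mxE mulr1 => <-.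
rewrite mulr_suml; apply: ler_sum => j _; rewrite [const_mx _ _ _]mxE mulr1 normrM.
(* The eigenvector is a row, so column [i] of the matrix appears; symmetry turns it into row [i]. *)
rewrite mulrC -[in X in _ <= X]tr_Aalpha [_^T i j]mxE ger0_norm //.
exact: ler_wpM2l.
Qed.

(** The degree is the largest eigenvalue, attained at the all-ones vector, which is nonzero because
    the graph is nonempty. *)
Lemma cospectral_regular_degree (R : realType) (alpha : R) (G1 G2 : sgraph) r1 r2 :
  0 <= alpha <= 1 -> (0 < #|G1|)%N ->
  (forall x : G1, degree x = r1) -> (forall x : G2, degree x = r2) ->
  char_poly (Aalpha alpha G1) = char_poly (Aalpha alpha G2) -> r1 = r2.
Proof.
move=> ha G10 d1 d2 eqc; have n12 := eq_char_poly_size eqc.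
have G20 : (0 < #|G2|)%N by rewrite -n12.
apply/eqP; rewrite eqn_leq -!(ler_nat R); apply/andP; split.
  apply: (regular_eigenvalue_le ha d2).
  by rewrite eigenvalue_root_char -eqc -eigenvalue_root_char regular_eigenvalue.
apply: (regular_eigenvalue_le ha d1).
by rewrite eigenvalue_root_char eqc -eigenvalue_root_char regular_eigenvalue.
Qed.

(** The coronal at a point of the field. At an eigenvalue of [M] the value is junk, since [invmx]
    returns a singular matrix unchanged. *)
Definition coronal_at (F : fieldType) n (M : 'M[F]_n) (x : F) : F :=
  ((const_mx 1 : 'rV_n) *m invmx (x%:M - M) *m (const_mx 1 : 'cV_n)) 0 0.

(** The numerator of the coronal over the denominator [char_poly M]; it links the rational function
    to its point values. *)
Definition coronal_num (R : comNzRingType) n (M : 'M[R]_n) : {poly R} :=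
  ((const_mx 1 : 'rV_n) *m \adj (char_poly_mx M) *m (const_mx 1 : 'cV_n)) 0 0.

Lemma coronal_atE (F : fieldType) n (M : 'M[F]_n) x : (char_poly M).[x] != 0 ->
  coronal_at M x = (coronal_num M).[x] / (char_poly M).[x].
Proof.
move=> cx; have u : x%:M - M \in unitmx.
  by rewrite unitmxE unitfE -horner_char_poly.
rewrite /coronal_at /invmx u -horner_char_poly -scalemxAr -scalemxAl mxE mulrC.
congr (_ * _); rewrite -[RHS]/(horner_eval x _) /coronal_num.
set N := (_ *m _ *m _ : 'M[{poly F}]_1).
have -> : horner_eval x (N 0 0) = map_mx (horner_eval x) N 0 0 by rewrite [RHS]mxE.
rewrite /N !map_mxM !map_const_mx rmorph1 map_mx_adj; congr ((_ *m \adj _ *m _) 0 0).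
apply/matrixP => i j; rewrite !mxE /= /horner_eval !hornerE.
by rewrite hornerMn hornerX.
Qed.

Lemma coronalE (R : realType) n (M : 'M[R]_n) :
  coronal M = tofrac (coronal_num M) / tofrac (char_poly M).
Proof.
rewrite /coronal /coronal_num.
have -> : (tofrac 'X)%:M - map_mx (fun a => tofrac a%:P) M =
          map_mx (@tofrac {poly R}) (char_poly_mx M).
  by apply/matrixP => i j; rewrite !mxE rmorphB rmorphMn.
set T := map_mx _ _; have dT : \det T = tofrac (char_poly M) by rewrite det_map_mx.
have u : T \in unitmx.
  by rewrite unitmxE unitfE dT tofrac_eq0 monic_neq0 // char_poly_monic.
rewrite /invmx u dT -scalemxAr -scalemxAl mxE mulrC; congr (_ / _).
set N := (_ *m _ *m _ : 'M[{poly R}]_1).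
have -> : tofrac (N 0 0) = map_mx (@tofrac {poly R}) N 0 0 by rewrite [RHS]mxE.
by rewrite /N !map_mxM !map_const_mx rmorph1 map_mx_adj trmx_const.
Qed.

Lemma eq_coronal_at (R : realType) m n (M : 'M[R]_m) (N : 'M[R]_n) x :
  coronal M = coronal N -> char_poly M = char_poly N ->
  (char_poly M).[x] != 0 -> coronal_at M x = coronal_at N x.
Proof.
rewrite !coronalE => eqc eqp px; move: (eqc); rewrite -eqp => /mulIf.
rewrite invr_eq0 tofrac_eq0 monic_neq0 ?char_poly_monic // => /(_ isT)/eqP.
by rewrite tofrac_eq => /eqP eqn; rewrite !coronal_atE -?eqp // eqn.
Qed.

(** Subtracting [B^T] times the first block row from the second cancels [b *: (B^T *m B)]. Only [c]
    is then inverted, and [B] survives only through [B *m B^T]. *)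
Lemma det_incidence_block (F : fieldType) n m (P : 'M[F]_n) (B : 'M[F]_(n, m)) b c :
  c != 0 ->
  \det (block_mx P (- b *: B) (- b *: B^T) (c%:M - b *: (B^T *m B))) =
  c ^+ m * \det (P - c^-1 *: (b *: (B *m B^T) *m (b%:M + P))).
Proof.
move=> c0; have uc : c%:M \in @unitmx F m by rewrite unitmxE det_scalar unitrX ?unitfE.
have -> : \det (block_mx P (- b *: B) (- b *: B^T) (c%:M - b *: (B^T *m B))) =
    \det (block_mx P (- b *: B) (- b *: B^T - B^T *m P) c%:M).
  rewrite -[LHS]mul1r -[in LHS](det1 F (n + m)).
  have <- : \det (block_mx 1%:M 0 (- B^T) 1%:M) = \det (1%:M : 'M[F]_(n + m)).
    by rewrite det_lblock !det1 mulr1.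
  rewrite -det_mulmx mulmx_block !mul1mx !mul0mx !addr0 !mulNmx -scalemxAr.
  congr (\det (block_mx _ _ _ _)); first by rewrite addrC.
  by rewrite scaleNr opprK addrC subrK.
rewrite det_block_schur // det_scalar invmx_scalar mul_mx_scalar.
congr (_ * \det (_ - _)); rewrite -!scalemxAl -mulmxA scaleNr -scalerN -mulmxN.
congr (_ *: (_ *: (_ *m _))).
by rewrite mulmxDr mul_mx_scalar scaleNr opprB opprK addrC.
Qed.

(** * The characteristic polynomial of the Q-vertex join *)

Section JoinCharPoly.
Variables (R : realType) (alpha : R) (G H : sgraph) (r : nat).
Hypothesis dr : forall x : G, degree x = r.
Local Notation X := (Qvertex_join G H).
Local Notation b := (1 - alpha).

Definition incidence_mx : 'M[R]_(#|G|, #|edge G|) := fmx (fun x (e : edge G) => (x \in val e)%:R).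

Lemma incidence_mul_tr :
  b *: (incidence_mx *m incidence_mx^T) = Aalpha alpha G + ((b - alpha) * r%:R)%:M.
Proof.
rewrite tr_fmx fmxM AalphaE -fmx_scalar fmxD fmxZ; apply: eq_fmx => x y.
have -> : \sum_(e : edge G) (x \in val e)%:R * (y \in val e)%:R =
          #|[set e : edge G | (x \in val e) && (y \in val e)]|%:R :> R.
  rewrite -sum1dep_card natr_sum [RHS]big_mkcond /=; apply: eq_bigr => e _.
  by case: (x \in _); case: (y \in _); rewrite ?mulr0 ?mul0r ?mulr1.
rewrite dr; have [->|xy] := eqVneq x y; last by rewrite card_edge_at2 // !mulr0 add0r addr0.
rewrite adj_irr (eq_card (B := mem [set e : edge G | y \in val e])) ?card_edge_at ?dr.
  by rewrite /=; ring.
by move=> e; rewrite !inE andbb.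
Qed.

Lemma tr_incidence_mul :
  incidence_mx^T *m incidence_mx =
  fmx (fun e f : edge G => #|val e :&: val f|%:R).
Proof.
rewrite tr_fmx fmxM; apply: eq_fmx => e f.
rewrite -sum1_card natr_sum [RHS]big_mkcond /=; apply: eq_bigr => x _.
by rewrite inE; case: (x \in _); case: (x \in _); rewrite ?mulr0 ?mul0r ?mulr1.
Qed.

Section AtPoint.
Variable l : R.

(* After eliminating H and then the inserted vertices, l - Aalpha X reduces to
   x + y Aalpha(G) + z J, where J is all ones, and s is its row sum
   when z = 0. *)
Definition join_c := l - alpha * (2 * r)%:R + 2 * b.
Definition join_p := l - alpha * (r + #|H|)%:R.
Definition join_g := b ^+ 2 * coronal_at (Aalpha alpha H) (l - alpha * #|G|%:R).
Definition join_y := - (b + join_p) / join_c.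
Definition join_x := join_p + join_y * ((b - alpha) * r%:R).
Definition join_z := join_g * (2 * b * r%:R) / join_c - join_g.
Definition join_s := join_p + join_y * (2 * b * r%:R).

Let entry (x y : X) : R :=
  (l - alpha * (degree x)%:R) * (x == y)%:R - b * (adj x y)%:R.

Lemma join_entry : l%:M - Aalpha alpha X = fmx entry.
Proof.
rewrite AalphaE -fmx_scalar fmxN fmxD; apply: eq_fmx => x y; rewrite /entry; ring.
Qed.

Let orig : 'cV[R]_#|Qgraph G| := \col_i (original (enum_val i))%:R.

Let entryQ (x y : Qgraph G) : R :=
  entry (inl x) (inl y) - join_g * ((original x)%:R * (original y)%:R).

(** The block between Q(G) and [H] has rank one, [orig] times an all-ones row, so the inverse of the
    [H] block enters only through its sum of entries. *)
Lemma det_join_second :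
  (char_poly (Aalpha alpha H)).[l - alpha * #|G|%:R] != 0 ->
  \det (l%:M - Aalpha alpha X) =
  (char_poly (Aalpha alpha H)).[l - alpha * #|G|%:R] * \det (fmx entryQ).
Proof.
move=> chi0; rewrite join_entry det_fmx_sum.
have -> : fmx (fun x y : H => entry (inr x) (inr y)) =
          (l - alpha * #|G|%:R)%:M - Aalpha alpha H.
  rewrite AalphaE -fmx_scalar fmxN fmxD; apply: eq_fmx => x y.
  by rewrite /entry degree_second natrD /= (inj_eq inr_inj); ring.
have -> : fmx (fun x y => entry (inl x) (inr y)) = - b *: (orig *m (const_mx 1 : 'rV_#|H|)).
  by apply/matrixP => i j; rewrite !mxE big_ord1 !mxE /entry /=; ring.
have -> : fmx (fun x y => entry (inr x) (inl y)) = - b *: ((const_mx 1 : 'cV_#|H|) *m orig^T).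
  by apply/matrixP => i j; rewrite !mxE big_ord1 !mxE /entry /=; ring.
rewrite det_block_schur -?horner_char_poly; last first.
  by rewrite unitmxE unitfE -horner_char_poly.
congr (_ * \det _); rewrite -scalemxAr -!scalemxAl scalerA.
set D := invmx _.
have -> : orig *m const_mx 1 *m D *m (const_mx 1 *m orig^T) =
    orig *m (const_mx 1 *m D *m const_mx 1) *m orig^T by rewrite !mulmxA.
rewrite [const_mx 1 *m D *m _]mx11_scalar -/(coronal_at _ _) mul_mx_scalar -scalemxAl scalerA.
apply/matrixP => i j; rewrite !mxE big_ord1 !mxE /entryQ /join_g; ring.
Qed.

Let B := incidence_mx.

(** The summand [2 * b] of [join_c] compensates for the diagonal entries 2 of [B^T *m B]. *)
Lemma det_join_edges :
  \det (fmx entryQ) =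
  \det (block_mx (join_p%:M - join_g *: const_mx 1) (- b *: B) (- b *: B^T)
                 (join_c%:M - b *: (B^T *m B))).
Proof.
rewrite (@det_fmx_sum _ G (edge G) entryQ); congr (\det (block_mx _ _ _ _)).
- rewrite -fmx_const -fmx_scalar fmxZ fmxN fmxD; apply: eq_fmx => x y.
  by rewrite /entryQ /entry degree_original dr /join_p !natrD /= !(inj_eq inl_inj); ring.
- by rewrite fmxZ; apply: eq_fmx => x e; rewrite /entryQ /entry /=; ring.
- by rewrite tr_fmx fmxZ; apply: eq_fmx => x e; rewrite /entryQ /entry /=; ring.
rewrite tr_incidence_mul -fmx_scalar fmxZ fmxN fmxD; apply: eq_fmx => e f.
rewrite /entryQ /entry (degree_inserted _ _ dr) /join_c /=.
rewrite (inj_eq inl_inj) (inj_eq inr_inj).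
have [->|ef] := eqVneq e f; first by rewrite setIid card_edge /=; ring.
by rewrite card_edgeI //=; ring.
Qed.

Lemma char_poly_join :
  (char_poly (Aalpha alpha H)).[l - alpha * #|G|%:R] != 0 ->
  join_c != 0 -> join_s != 0 ->
  (char_poly (Aalpha alpha X)).[l] =
  (char_poly (Aalpha alpha H)).[l - alpha * #|G|%:R] * (join_c ^+ #|edge G| *
  (\det (join_x%:M + join_y *: Aalpha alpha G) *
   \det (1%:M + (join_z / join_s) *: const_mx 1 : 'M_#|G|))).
Proof.
move=> chi0 c0 s0; rewrite horner_char_poly det_join_second // det_join_edges.
rewrite det_incidence_block // incidence_mul_tr -det_add_const_mx //; last first.
  rewrite mulmxDl mul_scalar_mx -scalemxAl (Aalpha_regular alpha dr) scalerA -scalerDl.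
  by congr (_ *: _); rewrite /join_s /join_x; ring.
congr (_ * (_ * \det _)).
(* By [AJ], the matrix [b *: (B *m B^T)] sends [J] to [2 * b * r] times [J], so the product only
   yields multiples of 1, [A] and [J]. *)
set A := Aalpha alpha G; set J : 'M_#|G| := const_mx 1.
have AJ : A *m J = r%:R *: J := mulmx_const_square (Aalpha_regular alpha dr).
rewrite addrA -raddfD /= mulmxBr mul_mx_scalar mulmxDl -!scalemxAr AJ mul_scalar_mx.
apply/matrixP => i j; rewrite !mxE /join_x /join_z /join_y.
by case: (i == j); rewrite ?mulr1n ?mulr0n; field.
Qed.

End AtPoint.
End JoinCharPoly.

(** Both factors vary, so that the two halves of the theorem are the cases [H1 = H2] and
    [G1 = G2]. *)
Lemma char_poly_join_eq (R : realType) (alpha : R) (G1 G2 H1 H2 : sgraph) r :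
  (forall x : G1, degree x = r) -> (forall x : G2, degree x = r) ->
  char_poly (Aalpha alpha G1) = char_poly (Aalpha alpha G2) ->
  char_poly (Aalpha alpha H1) = char_poly (Aalpha alpha H2) ->
  coronal (Aalpha alpha H1) = coronal (Aalpha alpha H2) ->
  char_poly (Aalpha alpha (Qvertex_join G1 H1)) =
  char_poly (Aalpha alpha (Qvertex_join G2 H2)).
Proof.
move=> d1 d2 eqG eqH eqcor.
have cG := eq_char_poly_size eqG; have cH := eq_char_poly_size eqH.
have cE : #|edge G1| = #|edge G2|.
  have := regular_card_edge d1; have := regular_card_edge d2; rewrite cG; lia.
pose b := 1 - alpha; pose t := alpha * #|G1|%:R.
pose c : {poly R} := 'X - (alpha * (2 * r)%:R - 2 * b)%:P.
pose p : {poly R} := 'X - (alpha * (r + #|H1|)%:R)%:P.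
(* The polynomial form of [join_s] with its denominator [join_c] cleared. *)
pose s := p * c - (b%:P + p) * (2 * b * r%:R)%:P.
have s0 : s != 0.
  (* [s] is a monic quadratic, so its second difference is 2. *)
  apply/eqP => s0; suff : s.[2] - 2 * s.[1] + s.[0] = 2.
    by rewrite s0 !horner0 => /eqP; rewrite mulr0 subrr addr0 eq_sym pnatr_eq0.
  by rewrite /s /p /c !(hornerD, hornerN, hornerM, hornerC, hornerX); ring.
have c0 : c != 0 by rewrite polyXsubC_eq0.
have w0 : (char_poly (Aalpha alpha H1) \Po ('X - t%:P)) * (c * s) != 0.
  by rewrite !mulf_neq0 // comp_poly2_eq0 ?size_XsubC // monic_neq0 // char_poly_monic.
apply: (poly_eq_off_roots w0).
move=> l; rewrite !hornerM horner_comp !mulf_eq0 !negb_or hornerXsubC => /and3P [chi0 cl sl].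
have cE1 : c.[l] = join_c alpha r l by rewrite /c hornerXsubC /join_c /b; ring.
have jc0 : join_c alpha r l != 0 by rewrite -cE1.
have js0 : join_s alpha H1 r l != 0.
  apply: contra sl => /eqP js; have : join_s alpha H1 r l * join_c alpha r l = s.[l].
    have -> : s.[l] = p.[l] * c.[l] - (b + p.[l]) * (2 * b * r%:R).
      by rewrite /s !(hornerD, hornerN, hornerM, hornerC).
    have -> : p.[l] = join_p alpha H1 r l by rewrite hornerXsubC.
    by rewrite cE1 /join_s /join_y /b; field.
  by rewrite js mul0r => <-.
have sE : join_s alpha H1 r l = join_s alpha H2 r l.
  by rewrite /join_s /join_y /join_p cH.
have xE : join_x alpha H1 r l = join_x alpha H2 r l by rewrite /join_x /join_y /join_p cH.
have yE : join_y alpha H1 r l = join_y alpha H2 r l by rewrite /join_y /join_p cH.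
have zE : join_z alpha G1 H1 r l = join_z alpha G2 H2 r l.
  by rewrite /join_z /join_g (eq_coronal_at eqcor eqH chi0) /t cG.
have chi0' : (char_poly (Aalpha alpha H2)).[l - alpha * #|G2|%:R] != 0 by rewrite -eqH -cG.
rewrite (char_poly_join d1) // (char_poly_join d2) // -?sE // -eqH -cE -xE -yE -zE.
rewrite (det_scalar_add_eq _ _ eqG).
have shift_det u : \det (1%:M + u *: const_mx 1 : 'M_#|G1|) =
                   \det (1%:M + u *: const_mx 1 : 'M_#|G2|) by rewrite cG.
by rewrite shift_det cG.
Qed.

(** * Cancellation of the factors *)

Section Cancellation.
Variables W A B : finType.
Variable phi : W + A -> W + B.
Hypothesis phi_bij : bijective phi.

Local Notation step a := (fun x : W + A =>
  match phi x with inl w => inl w | inr _ => inr a end : W + A).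
Local Notation orb a i := (iter i (step a) (inr a)).
Local Notation hit x := ((if phi x is inr _ then true else false) : bool).

(** An orbit that never lands in [B] stays in [W] after its start. By injectivity of [phi] a
    coincidence can be pulled back to time 0, where the orbit is at [inr a], outside [W]; so all its
    points differ, too many for a finite type. *)
Lemma orbit_hits a : exists i, hit (orb a i).
Proof.
case: (pickP (fun i : 'I_#|{: W + A}|.+1 => hit (orb a i))) => [i hi|nohit].
  by exists i.
pose N := #|{: W + A}|.
have stepE i : (i <= N)%N -> exists2 w, orb a i.+1 = inl w & phi (orb a i) = inl w.
  move=> iN; have := nohit (Ordinal (iN : (i < N.+1)%N)); rewrite iterS /=.
  by case: (phi _) => // w _; exists w.
have back i j : (i <= N)%N -> (j <= N)%N -> orb a i.+1 = orb a j.+1 -> orb a i = orb a j.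
  move=> iN jN; have [w -> wi] := stepE i iN; have [w' -> wj] := stepE j jN.
  by case=> ww'; apply: (bij_inj phi_bij); rewrite wi wj ww'.
have inj_orb i j : (i < j)%N -> (j <= N)%N -> orb a i != orb a j.
  elim: i j => [|i IHi] [|j] // ij jN; apply/eqP.
    by have [w -> _] := stepE j (ltnW jN).
  have iN := ltnW (ltn_trans (ij : (i < j)%N) jN).
  by move/(back _ _ iN (ltnW jN))/eqP; apply/negP/IHi => //; apply: ltnW.
suff : (#|'I_N.+1| <= #|{: W + A}|)%N by rewrite card_ord ltnn.
apply: (leq_card (fun i : 'I_N.+1 => orb a i)) => i j /eqP eqij.
apply: val_inj => /=; case: (ltngtP i j) => // lt.
  by move: eqij; rewrite (negPf (inj_orb _ _ lt _)) // -ltnS.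
by move: eqij; rewrite eq_sym (negPf (inj_orb _ _ lt _)) // -ltnS.
Qed.

(* The return map of phi to B.  To compare the orbits of a and a', which need
   not return simultaneously, restart each orbit at its origin whenever it
   returns: with periods p and p', both return at time p * p'. *)
Lemma first_return : exists g : A -> B,
  forall (RA : rel (W + A)) (RB : rel (W + B)),
  (forall x y, RB (phi x) (phi y) = RA x y) ->
  (forall w w', RA (inl w) (inl w') = RB (inl w) (inl w')) ->
  (forall w a b, RA (inl w) (inr a) = RB (inl w) (inr b)) ->
  (forall w a b, RA (inr a) (inl w) = RB (inr b) (inl w)) ->
  forall a a', RB (inr (g a)) (inr (g a')) = RA (inr a) (inr a').
Proof.
(* At time [s a] the orbit is one application of [phi] before landing in [B], so the restarted orbit
   has period [(s a).+1]. *)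
pose s a := ex_minn (orbit_hits a).
have period a i : orb a (i + (s a).+1) = orb a i.
  rewrite iterD; congr (iter i _ _) => /=.
  by rewrite /s; case: ex_minnP => m; case: (phi _).
have period_mod a i : orb a i = orb a (i %% (s a).+1)%N.
  rewrite {1}(divn_eq i (s a).+1) addnC.
  by elim: (i %/ _)%N => [|q IH]; rewrite ?addn0 // mulSnr addnA period.
have {period} hit_mod a i : hit (orb a i) -> (i %% (s a).+1 = s a)%N.
  rewrite period_mod; have := ltn_pmod i (ltn0Sn (s a)); rewrite ltnS leq_eqVlt.
  case/predU1P=> // lt; rewrite {2 4}/s in lt *; case: ex_minnP lt => m _ min lt hi.
  by have := min _ hi; rewrite leqNgt lt.
have gP a : {b | phi (orb a (s a)) = inr b}.
  case E: (phi _) => [w|b]; last by exists b.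
  by exfalso; move: E; rewrite /s; case: ex_minnP => m; case: (phi _).
exists (fun a => sval (gP a)) => RA RB RBE RWW RWr RWl a a'.
case: (gP a) (gP a') => b /= hb [b' /= hb'].
have hitE c d i e : phi (orb c (s c)) = inr d -> phi (orb c i) = inr e -> e = d.
  move=> hd he; have := hit_mod c i; rewrite he => /(_ isT) im.
  by move: he; rewrite period_mod im hd => -[].
(* Invariant: the orbits stay related as [a] and [a'] are, until both land in [B] at the same time,
   which is the goal. If only one lands, its restart keeps the relation because relations between
   [W] and [A] or [B] depend only on the point of [W]. *)
have track i : RB (inr b) (inr b') = RA (inr a) (inr a') \/
               RA (orb a i) (orb a' i) = RA (inr a) (inr a').
  elim: i => [|i [->|IH]]; [by right|by left|].
  rewrite !iterS; have := RBE (orb a i) (orb a' i); rewrite IH.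
  case Ea: (phi (orb a i)) => [w|d]; case Ea': (phi (orb a' i)) => [w'|d'] <-.
  - by right; apply: RWW.
  - by right; apply: RWr.
  - by right; apply: RWl.
  by left; rewrite (hitE _ _ _ _ hb Ea) (hitE _ _ _ _ hb' Ea').
have last_mod p q : (((p.+1 * q.+1).-1) %% p.+1 = p)%N.
  have -> : ((p.+1 * q.+1).-1 = q * p.+1 + p)%N by lia.
  by rewrite modnMDl modn_small.
(* One less than a common multiple of the periods: both orbits are about to land. *)
pose N := ((s a).+1 * (s a').+1).-1.
case: (track N) => // <-; rewrite -RBE (period_mod a N) (period_mod a' N).
by rewrite last_mod /N mulnC last_mod hb hb'.
Qed.

End Cancellation.

(** The map [g] is chosen before the relations, so it serves twice: with equality it gives
    injectivity, with adjacency the isomorphism. *)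
Lemma Qvertex_join_cancel (G H1 H2 : sgraph) :
  isomorphic (Qvertex_join G H1) (Qvertex_join G H2) -> isomorphic H1 H2.
Proof.
case=> phi [phi_bij phi_adj]; have [g gP] := first_return phi_bij.
have g_inj : injective g.
  move=> a a' gaa'; apply/eqP.
  have := gP eq_op eq_op; rewrite -(inj_eq (@inr_inj (Qgraph G) _)) => <- //.
    by rewrite gaa'.
  by move=> x y; rewrite (bij_eq phi_bij).
exists g; split; last by move=> x y; apply: (gP (@adj (Qvertex_join G H1)) (@adj (Qvertex_join G H2))).
apply: inj_card_bij g_inj _; have := bij_eq_card phi_bij.
by rewrite !card_sum => /addnI ->.
Qed.

(** * Recovering the regular factor from the join *)

Lemma card_eq_bij (S T : finType) : #|S| = #|T| -> {f : S -> T | bijective f}.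
Proof.
move=> eqST; exists (fun x => enum_val (cast_ord eqST (enum_rank x))).
exists (fun y => enum_val (cast_ord (esym eqST) (enum_rank y))) => x;
  by rewrite enum_valK ?cast_ordK ?cast_ordKV enum_rankK.
Qed.

Lemma degree0_iso (G1 G2 : sgraph) : #|G1| = #|G2| ->
  (forall x : G1, degree x = 0%N) -> (forall x : G2, degree x = 0%N) ->
  isomorphic G1 G2.
Proof.
move=> /card_eq_bij [f f_bij] d1 d2; exists f; split=> // x y.
have nadj (G : sgraph) : (forall z : G, degree z = 0%N) -> forall u v : G, adj u v = false.
  by move=> d u v; have /eqP := d u; rewrite cards_eq0 => /eqP/setP/(_ v); rewrite !inE.
by rewrite !nadj.
Qed.

Lemma degree_ltn (G : sgraph) (x : G) : (degree x < #|G|)%N.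
Proof.
rewrite -cardsT; apply: proper_card; apply/properP; split; first exact: subsetT.
by exists x; rewrite !inE ?adj_irr.
Qed.

Lemma complete_adj (G : sgraph) (x y : G) :
  (degree x).+1 = #|G| -> adj x y = (x != y).
Proof.
move=> dx; have : [set y | adj x y] == ~: [set x].
  rewrite eqEcard; apply/andP; split; last by rewrite cardsC1 -dx.
  by apply/subsetP => z; rewrite !inE; apply: contraTneq => ->; rewrite adj_irr.
by move=> /eqP/setP/(_ y); rewrite !inE eq_sym.
Qed.

Lemma complete_iso (G1 G2 : sgraph) : #|G1| = #|G2| ->
  (forall x : G1, (degree x).+1 = #|G1|) -> (forall x : G2, (degree x).+1 = #|G2|) ->
  isomorphic G1 G2.
Proof.
move=> /card_eq_bij [f f_bij] d1 d2; exists f; split=> // x y.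
by rewrite !complete_adj // (bij_eq f_bij).
Qed.

Lemma degree_iso (G1 G2 : sgraph) (f : G1 -> G2) x :
  bijective f -> (forall x y, adj (f x) (f y) = adj x y) -> degree (f x) = degree x.
Proof.
move=> f_bij f_adj; rewrite !degreeE (reindex f) /=; last exact: onW_bij.
by apply: eq_bigr => y _; rewrite f_adj.
Qed.

Section OriginalVertices.
Variables (G1 G2 H : sgraph) (r : nat).
Local Notation X1 := (Qvertex_join G1 H).
Local Notation X2 := (Qvertex_join G2 H).
Variables (phi : X1 -> X2).
Hypotheses (phi_bij : bijective phi)
  (phi_adj : forall x y, adj (phi x) (phi y) = adj x y).
Hypotheses (deg1 : forall x : G1, degree x = r) (deg2 : forall x : G2, degree x = r).
Hypotheses (r_gt0 : (0 < r)%N) (not_complete : (r.+1 < #|G1|)%N).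

(* The neighbourhood of an inserted vertex is covered by two cliques, one for
   each end of its edge, while that of an original vertex contains a clique on
   r inserted vertices and a disjoint copy of H without edges between them. *)
Lemma original_not_inserted v e : phi (inl (inl v)) <> inl (inr e).
Proof.
move=> ve.
(* A vertex [u] and the inserted vertices on its edges form a clique; those of the two ends of [e]
   cover the neighbourhood of [e]. *)
pose meets (u : G2) (z : X2) := match z with
  | inl (inl x) => x == u | inl (inr f) => u \in val f | inr _ => false end.
have meets_clique u (z z' : X2) : z != z' -> meets u z -> meets u z' -> adj z z'.
  case: z z' => [[x|f]|h] [[y|g]|h'] zz' //=.
  - by move=> /eqP xu /eqP yu; rewrite xu yu eqxx in zz'.
  - by move=> /eqP ->.
  - by move=> uf /eqP ->.
  move=> uf ug; rewrite (contra_neq _ zz') => [|->] //=.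
  by apply/set0Pn; exists u; rewrite inE uf.
have nbr_meets (z : X2) : adj (inl (inr e) : X2) z -> exists2 u, u \in val e & meets u z.
  case: z => [[x|f]|h] //=; first by exists x.
  by case/andP=> _ /set0Pn [u /setIP [ue uf]]; exists u.
have [a [b [_ _ eE]]] := edge_ends e.
(* By pigeonhole two of the three neighbours of [v] are sent into the same clique. *)
have claw_free (z1 z2 z3 : X1) : uniq [:: z1; z2; z3] ->
    (forall z, z \in [:: z1; z2; z3] -> adj (inl (inl v) : X1) z) ->
    [|| adj z1 z2, adj z1 z3 | adj z2 z3].
  move=> un nb; have nbm z : z \in [:: z1; z2; z3] -> meets a (phi z) || meets b (phi z).
    move=> /nb; rewrite -phi_adj ve => /nbr_meets [u].
    by rewrite eE !inE => /orP [] /eqP -> ->; rewrite ?orbT.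
  move: un; rewrite /= !inE negb_or andbT => /andP [/andP [n12 n13] n23].
  have cl u z z' : z != z' -> meets u (phi z) -> meets u (phi z') -> adj z z'.
    by move=> zz' mz mz'; rewrite -phi_adj (meets_clique u) // (bij_eq phi_bij).
  have /allP : {in [:: z1; z2; z3], forall z, meets a (phi z) || meets b (phi z)} := nbm.
  rewrite /= andbT => /and3P [].
  move=> /orP [] m1 /orP [] m2 /orP [] m3; apply/or3P;
    solve [constructor 1; exact: cl n12 m1 m2 | constructor 2; exact: cl n13 m1 m3
          | constructor 3; exact: cl n23 m2 m3].
have [g vg] : exists g : edge G1, v \in val g by apply: edge_at; rewrite deg1.
(* Comparing degrees of [v] and its image gives [r + #|H| = 2 * r]. *)
have kr : #|H| = r.
  have := degree_iso (inl (inl v) : X1) phi_bij phi_adj.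
  by rewrite ve (degree_inserted _ _ deg2) degree_original deg1; lia.
(* The inserted vertex [g] next to [v] has no neighbour in [H], so it serves as the third vertex. *)
have H_complete (h h' : H) : h != h' -> adj h h'.
  move=> hh'; have := claw_free (inr h) (inr h') (inl (inr g)).
  rewrite /= !orbF; apply; first by rewrite !inE !negb_or /= hh'.
  by move=> z; rewrite !inE => /or3P [] /eqP ->.
have [h _] : exists h : H, true.
  by move: r_gt0; rewrite -kr => /card_gt0P [h _]; exists h.
have degh : (degree h).+1 = r.
  have -> : degree h = #|~: [set h]|.
    apply: eq_card => h'; rewrite !inE; have [->|hh'] := eqVneq h' h; first exact: adj_irr.
    by apply: H_complete; rewrite eq_sym.
  by rewrite cardsC1 -kr prednK // kr.
(* Every neighbour of the image of [v] has degree [2 * r], but [h] has degree [#|G1| + r - 1], which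
   is larger since [r.+1 < #|G1|]. *)
have : (degree (phi (inr h)) <= 2 * r)%N.
  have : adj (phi (inl (inl v))) (phi (inr h)) by rewrite phi_adj.
  rewrite ve; case: (phi _) => [[x|f]|//] _.
    by rewrite degree_original deg2 kr; lia.
  by rewrite (degree_inserted _ _ deg2).
rewrite (degree_iso _ phi_bij phi_adj) degree_second; lia.
Qed.

End OriginalVertices.

Section QvertexJoinLeft.
Variables (G1 G2 H : sgraph) (r : nat).
Local Notation X1 := (Qvertex_join G1 H).
Local Notation X2 := (Qvertex_join G2 H).
Variables (phi : X1 -> X2) (psi : X2 -> X1).
Hypotheses (phiK : cancel phi psi) (psiK : cancel psi phi).
Hypotheses (phi_adj : forall x y, adj (phi x) (phi y) = adj x y).
Hypotheses (card_eq : #|G1| = #|G2|).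
Hypotheses (deg1 : forall x : G1, degree x = r) (deg2 : forall x : G2, degree x = r).
Hypotheses (r_gt0 : (0 < r)%N) (not_complete : (r.+1 < #|G1|)%N).

Let phi_inj := can_inj phiK.

Let phi_original v e : phi (inl (inl v)) <> inl (inr e).
Proof. by apply: (original_not_inserted (r := r)) => //; exists psi. Qed.

Let phi_inserted e v : phi (inl (inr e)) <> inl (inl v).
Proof.
move=> ev; suff : psi (inl (inl v)) <> inl (inr e) by rewrite -ev phiK.
apply: (original_not_inserted (r := r)) => //; last by rewrite -card_eq.
- by exists phi.
- by move=> x y; rewrite -phi_adj !psiK.
Qed.

(** An inserted neighbour [g] of [v] has no good image: inserted vertices miss [inr h], while
    vertices of [H] are adjacent to [w], although [g] is not adjacent to [h']. *)
Lemma original_not_second v h : phi (inl (inl v)) <> inr h.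
Proof.
(* Otherwise [psi] maps originals injectively to originals, hence onto them by equal orders, and [v]
   would be sent to an original. *)
move=> vh; have [w [h' h'w]] : exists w h', phi (inr h') = inl (inl w).
  case: (pickP (fun w => if psi (inl (inl w)) is inr _ then true else false)) => [w|no].
    by case E: (psi _) => [|h'] // _; exists w, h'; rewrite -E psiK.
  have ps w : {u | psi (inl (inl w)) = inl (inl u)}.
    have := no w; case E: (psi _) => [[u|e]|] // _; first by exists u.
    by case: (@phi_inserted e w); rewrite -E psiK.
  have ps_inj : injective (fun w => sval (ps w)).
    move=> w w' ww'; have := erefl (phi (psi (inl (inl w)))).
    by rewrite {2}(svalP (ps w)) ww' -(svalP (ps w')) !psiK => -[].
  have [k _ kK] : bijective (fun w => sval (ps w)).
    by apply: inj_card_bij; rewrite ?card_eq.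
  by move: vh; rewrite -(kK v) -(svalP (ps (k v))) psiK.
have [g vg] : exists g : edge G1, v \in val g by apply: edge_at; rewrite deg1.
have gv : adj (inl (inr g) : X1) (inl (inl v)) by [].
have gh' : adj (inl (inr g) : X1) (inr h') = false by [].
move: gv gh'; rewrite -!phi_adj vh h'w; case E: (phi _) => [[u|f]|h''] //.
by case: (phi_inserted E).
Qed.

Lemma image_original v : {w | phi (inl (inl v)) = inl (inl w)}.
Proof.
case E: (phi _) => [[w|e]|h]; first by exists w.
  by case: (phi_original E).
by case: (original_not_second E).
Qed.

Lemma image_original_adj x y : adj x y ->
  adj (sval (image_original x)) (sval (image_original y)).
Proof.
move=> xy; case: image_original => u xu; case: image_original => w yw /=.
have uw : u != w.
  apply: contraTneq xy => uw; have : phi (inl (inl x)) = phi (inl (inl y)) by rewrite xu yw uw.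
  by move/phi_inj => [->]; rewrite adj_irr.
have [e eE] := adj_edge xy.
have ex : adj (inl (inr e) : X1) (inl (inl x)) by rewrite /= eE !inE eqxx.
have ey : adj (inl (inr e) : X1) (inl (inl y)) by rewrite /= eE !inE eqxx orbT.
move: ex ey; rewrite -!phi_adj xu yw; case E: (phi (inl (inr e))) => [[z|f]|h] //=.
  by move=> uf wf; apply: edge_adj uw uf wf.
(* An image of [e] in [H] would be adjacent to all original vertices, so the two ends of [e] would
   exhaust [G1], which has more than [r.+1] vertices. *)
suff /subset_leq_card : [set: G1] \subset val e.
  by rewrite cardsT card_edge => n2; move: not_complete; lia.
apply/subsetP => z _; suff : adj (inl (inr e) : X1) (inl (inl z)) by [].
by rewrite -phi_adj E; case: (image_original z) => z' ->.
Qed.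

End QvertexJoinLeft.

Lemma Qvertex_join_iso_left (G1 G2 H : sgraph) (r : nat) : #|G1| = #|G2| ->
  (forall x : G1, degree x = r) -> (forall x : G2, degree x = r) ->
  isomorphic (Qvertex_join G1 H) (Qvertex_join G2 H) -> isomorphic G1 G2.
Proof.
move=> card_eq deg1 deg2 [phi [[psi phiK psiK] phi_adj]].
case: (posnP r) => [r0|r_gt0]; first by apply: degree0_iso => // x; rewrite ?deg1 ?deg2.
have [n_le|not_complete] := leqP #|G1| r.+1.
  apply: complete_iso => // x; have := degree_ltn x.
    by rewrite deg1; lia.
  by rewrite deg2 -card_eq; lia.
have psi_adj x y : adj (psi x) (psi y) = adj x y by rewrite -phi_adj !psiK.
have nc2 : (r.+1 < #|G2|)%N by rewrite -card_eq.
pose f := image_original phiK psiK phi_adj card_eq deg1 deg2 r_gt0 not_complete.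
pose g := image_original psiK phiK psi_adj (esym card_eq) deg2 deg1 r_gt0 nc2.
have fK : cancel (fun x => sval (f x)) (fun x => sval (g x)).
  by move=> x; case: (etrans (esym (svalP (g _))) (etrans (congr1 psi (esym (svalP (f x)))) (phiK _))).
have gK : cancel (fun x => sval (g x)) (fun x => sval (f x)).
  by move=> x; case: (etrans (esym (svalP (f _))) (etrans (congr1 phi (esym (svalP (g x)))) (psiK _))).
exists (fun x => sval (f x)); split; first by exists (fun x => sval (g x)).
move=> x y; apply/idP/idP; last exact: image_original_adj.
by move/(image_original_adj psiK phiK psi_adj (esym card_eq) deg2 deg1 r_gt0 nc2); rewrite fK fK.
Qed.

Theorem corollary3p3 (R : realType) (alpha : R) (halpha : 0 <= alpha <= 1) :
  (forall G1 G2 H : sgraph,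
     regular G1 -> regular G2 ->
     Acospectral alpha G1 G2 ->
     Acospectral alpha (Qvertex_join G1 H) (Qvertex_join G2 H))
  /\
  (forall G H1 H2 : sgraph,
     regular G ->
     coronal (Aalpha alpha H1) = coronal (Aalpha alpha H2) ->
     Acospectral alpha H1 H2 ->
     Acospectral alpha (Qvertex_join G H1) (Qvertex_join G H2)).
Proof.
split=> [G1 G2 H [r1 d1] [r2 d2]|G H1 H2 [r dr] eqcor] [not_iso /char_poly_eq_spectrum eqc].
  have n12 := eq_char_poly_size eqc.
  (* Degrees can be compared only once emptiness is excluded: an empty graph is regular of every
     degree, but two empty graphs are isomorphic. *)
  have G1_gt0 : (0 < #|G1|)%N.
    case: (posnP #|G1|) => // G10; case: not_iso; apply: degree0_iso => // x.
      by have := card0_eq G10 x; rewrite inE.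
    by have := card0_eq (etrans (esym n12) G10) x; rewrite inE.
  have r12 := cospectral_regular_degree halpha G1_gt0 d1 d2 eqc; subst r2.
  split; first by move/(Qvertex_join_iso_left n12 d1 d2).
  by apply: spectrum_eq_char_poly; apply: (char_poly_join_eq d1 d2).
split; first by move/Qvertex_join_cancel.
by apply: spectrum_eq_char_poly; apply: (char_poly_join_eq dr dr).
Qed.
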